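(* Let $X$ be a finite nonempty set, let $C$ be a simplicial complex with $\bigcup C\subseteq X$, let $n\geq 0$, let $B_0$ be a building set of $C$, and for $1\leq i\leq n$ let $B_i$ be a building set of $\widetilde{\mathcal N}(C,B_0,\ldots,B_{i-1})$. Then the function $\mu_X^n\circ\sigma_X^{n+1}$ underlies an isomorphism between the simplicial complexes $\widetilde{\mathcal N}(C,B_0,\ldots,B_n)$ and $\mathrm{Ss}_X(C,B_0,\ldots,B_n)$.
   Context: A (finite abstract) simplicial complex is a set $C=P(\alpha_1)\cup\ldots\cup P(\alpha_m)$, $m\geq1$, where $P(\alpha)$ is the power set of $\alpha$ and $\alpha_1,\ldots,\alpha_m$ are finite, pairwise $\subseteq$-incomparable sets (the bases of $C$). For a function $f$ and a set $S$, $f[S]=\{f(s)\mid s\in S\}$. Simplicial complexes $C,D$ are isomorphic via a bijection $\varphi:\bigcup C\to\bigcup D$ such that $\alpha\in C$ iff $\varphi[\alpha]\in D$; a function $\psi$ underlies an isomorphism between $C$ and $D$ if its restriction to $\bigcup C$ is such a bijection. For a family of sets $B$ and a set $\beta$, $B_\beta=B\cap P(\beta)$. For a finite set $\alpha$, a building set of $P(\alpha)$ is a set $B$ of nonempty subsets of $\alpha$ such that (B1) if $\beta,\gamma\in B$ and $\beta\cap\gamma\neq\emptyset$ then $\beta\cup\gamma\in B$, and (B2) $\{a\}\in B$ for every $a\in\alpha$. A building set of a simplicial complex $C$ with bases $\alpha_1,\ldots,\alpha_m$ is a set $B\subseteq C$ such that $B_{\alpha_i}$ is a building set of $P(\alpha_i)$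 for every $i$. For a family $N$, an $N$-antichain is a set $\{\beta_1,\ldots,\beta_t\}\subseteq N$ with $t\geq2$ whose members are pairwise $\subseteq$-incomparable. For $B$ a building set of $C$, a subset $N\subseteq B$ is nested if for every $N$-antichain $\{\beta_1,\ldots,\beta_t\}$ the union $\beta_1\cup\ldots\cup\beta_t$ belongs to $C- B$. $\widetilde{\mathcal N}(C,B)$ is the simplicial complex of all nested subsets of $B$. Iteratively, if $B_{i+1}$ is a building set of $\widetilde{\mathcal N}(C,B_0,\ldots,B_i)$, then $\widetilde{\mathcal N}(C,B_0,\ldots,B_{i+1})=\widetilde{\mathcal N}(\widetilde{\mathcal N}(C,B_0,\ldots,B_i),B_{i+1})$. For a set $Y$, $TY$ is the free commutative semigroup (without identity) generated by $Y$: its elements are formal sums $k_1y_1+\ldots+k_ry_r$ with $r\geq1$, distinct $y_j\in Y$ and positive integers $k_j$; each $y\in Y$ is identified with $1y\in TY$. $T^1Y=TY$, $T^{m+1}Y=T(T^mY)$, and the formal addition of $T^mY$ is written $+^m$. For $f:Y\to Z$, $Tf:TY\to TZ$ is the semigroup homomorphism extending $f$. $P_FY$ is the set of finite nonempty subsets of $Y$, and $P_Ff(A)=f[A]$. $\sigma_Y:P_FY\to TY$ maps $\{a_1,\ldots,a_k\}$ (distinct $a_j$) to $a_1+\ldots+a_k$; $\sigma^1_Y=\sigma_Y$ and $\sigma^{m+1}_Y=\sigma_{T^mY}\circ P_F\sigma^m_Y:P_F^{m+1}Y\to T^{m+1}Y$. $\mu_Y:T^2Y\to TY$ is the semigroup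 homomorphism extending the identity of $TY$ (it evaluates $+^2$ as $+$); $\mu^0_Y$ is the identity of $TY$ and $\mu^m_Y=\mu_Y\circ T\mu^{m-1}_Y:T^{m+1}Y\to TY$. For $C$ with $\bigcup C\subseteq Y$ and $B_0,\ldots,B_n$ as in the claim: $\mathrm{St}_Y(C,B_0,\ldots,B_n)=\{\sigma^{n+1}_Y[N]\mid N\in\widetilde{\mathcal N}(C,B_0,\ldots,B_n)\}$ and $\mathrm{Ss}_Y(C,B_0,\ldots,B_n)=\{\mu^n_Y[\alpha]\mid \alpha\in \mathrm{St}_Y(C,B_0,\ldots,B_n)\}$. *)

(* Defs.v *)
From HB Require Import structures.
From mathcomp Require Import all_boot finmap multiset.

Set Implicit Arguments.
Unset Strict Implicit.
Unset Printing Implicit Defensive.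

Local Open Scope mset_scope.
Local Open Scope fset_scope.

Section SimplicialComplexes.
Variable Y : choiceType.
Implicit Types (A C : {fset {fset Y}}).

Definition cup A : {fset Y} := \bigcup_(a <- A) a.

Definition incomparable A : bool :=
  all2rel [rel a b : {fset Y} | (a `<=` b) ==> (a == b)] A.

Definition has_bases C A : Prop :=
  [/\ A != fset0, incomparable A &
      C = \bigcup_(a <- A) fpowerset a].

Definition simplicial_complex C : Prop := exists A, has_bases C A.

End SimplicialComplexes.

Definition underlies_iso (Y Z : choiceType) (psi : Y -> Z)
    (C : {fset {fset Y}}) (D : {fset {fset Z}}) : Prop :=
  [/\ simplicial_complex C, simplicial_complex D,
      {in cup C &, injective psi}, psi @` cup C = cup D &
      forall a : {fset Y}, a `<=` cup C -> (a \in C) <-> (psi @` a \in D)].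

(* P_F Y: the nonempty finite subsets of Y. *)
Record PF (Y : choiceType) :=
  MkPF { PF_val :> {fset Y}; PF_neq0 : PF_val != fset0 }.

HB.instance Definition _ (Y : choiceType) := [isSub for @PF_val Y].
HB.instance Definition _ (Y : choiceType) := [Choice of PF Y by <:].

Lemma down_closed_complex (Y : choiceType) (C : {fset {fset Y}}) :
  fset0 \in C -> (forall a b : {fset Y}, a `<=` b -> b \in C -> a \in C) ->
  simplicial_complex C.
Proof.
move=> C0 Cdown.
pose A := [fset a in C | all (fun b => (a `<=` b) ==> (a == b)) C].
have maxA a : a \in C -> exists2 b, b \in A & a `<=` b.
  elim: {a}_.+1 {-2}a (ltnSn (#|` cup C| - #|` a|)) => // k IH a ltk aC.
  case: (boolP (all (fun b : {fset Y} => (a `<=` b) ==> (a == b)) C)) => [aA|].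
    by exists a; rewrite ?fsubset_refl // !inE aC.
  case/allPn => b bC; rewrite negb_imply => /andP[ab nab].
  have lt_ab : #|` a| < #|` b|.
    by apply: fproper_ltn_card; rewrite fproperEneq nab.
  have le_b : #|` b| <= #|` cup C| by apply/fsubset_leq_card/bigfcup_sup.
  case: (IH b) => // [|c cA bc]; last by exists c; last exact: fsubset_trans bc.
  rewrite -ltnS; apply: leq_trans ltk; rewrite ltnS.
  by apply: ltn_sub2l; first exact: leq_trans le_b.
exists A; split.
- by apply/fset0Pn; have [b bA _] := maxA _ C0; exists b.
- apply/allrelP => a b; rewrite !inE => /andP[_ /allP aA] /andP[bC _].
  exact: aA.
- apply/fsetP => a; apply/idP/bigfcupP => [/maxA[b bA ab]|[b]].
    by exists b; rewrite ?bA ?fpowersetE.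
  by rewrite andbT fpowersetE !inE => /andP[bC _] /Cdown; apply.
Qed.

Section BuildingSets.
Variable Y : choiceType.
Implicit Types (B N : {fset PF Y}) (C : {fset {fset Y}}) (a : {fset Y}).

Definition PF_family B : {fset {fset Y}} := [fset (PF_val b) | b in B].

Definition below B a : {fset PF Y} := [fset b in B | PF_val b `<=` a].

(* Nonemptiness of the members of B is carried by the type PF Y. *)
Definition building_set_power a B : Prop :=
  [/\ PF_family B `<=` fpowerset a,
      {in B &, forall b c, PF_val b `&` PF_val c != fset0 ->
                           PF_val b `|` PF_val c \in PF_family B} &
      forall y, y \in a -> [fset y] \in PF_family B].

Definition building_set C B : Prop :=
  PF_family B `<=` C /\
  forall A, has_bases C A -> {in A, forall a, building_set_power a (below B a)}.

Definition is_antichain N A : bool :=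
  [&& A `<=` N, 1 < #|` A| & incomparable (PF_family A)].

Definition nested C B N : bool :=
  (N `<=` B) &&
  [forall A : fpowerset N, is_antichain N (val A) ==>
     (cup (PF_family (val A)) \in C `\` PF_family B)].

Definition nested_complex C B : {fset {fset PF Y}} :=
  [fset N in fpowerset B | nested C B N].

Lemma nested_complexP C B : simplicial_complex (nested_complex C B).
Proof.
apply: down_closed_complex => [|N M sNM].
  rewrite !inE fpowersetE fsub0set /nested fsub0set /=.
  apply/forallP => -[A /=]; rewrite fpowersetE fsubset0 => /eqP->.
  by rewrite /is_antichain cardfs0 andbF.
rewrite !inE !fpowersetE => /and3P[MB _ /forallP nestM].
have NB := fsubset_trans sNM MB; rewrite NB /nested NB /=.
apply/forallP => -[A AN] /=; apply/implyP => /and3P[sAN A2 incA].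
have AM : A \in fpowerset M by rewrite fpowersetE (fsubset_trans sAN).
have /implyP := nestM [` AM]; apply => /=.
by rewrite /is_antichain A2 incA -fpowersetE AM.
Qed.

End BuildingSets.

(* T Y: the free commutative semigroup on Y.  A formal sum with positive
   coefficients and at least one term is a nonempty finite multiset. *)
Record T (Y : choiceType) :=
  MkT { T_val :> {mset Y}; T_neq0 : T_val != mset0 }.

HB.instance Definition _ (Y : choiceType) := [isSub for @T_val Y].
HB.instance Definition _ (Y : choiceType) := [Choice of T Y by <:].

HB.instance Definition _ (Y : choiceType) :=
  Monoid.isComLaw.Build {mset Y} mset0 (@msetD Y)
    (@msetDA Y) (@msetDC Y) (@mset0D Y).

Lemma msetD_neq0 (Y : choiceType) (u v : {mset Y}) :
  u != mset0 -> (u `+` v)%mset != mset0.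
Proof.
apply: contra_neq => uv0; apply/msetP => y; rewrite mset0E.
have /msetP/(_ y)/eqP := uv0.
by rewrite msetE2 mset0E addn_eq0 => /andP[/eqP].
Qed.

Lemma big_msetD_neq0 (I : Type) (Y : choiceType) (s : seq I) (g : I -> T Y) :
  0 < size s -> \big[@msetD Y/mset0]_(i <- s) T_val (g i) != mset0.
Proof. by case: s => // i s _; rewrite big_cons msetD_neq0 ?T_neq0. Qed.

Lemma T_unit_subproof (Y : choiceType) (y : Y) : [mset y]%mset != mset0.
Proof.
by apply/eqP => /msetP/(_ y); rewrite msetnxx mset0E.
Qed.
Definition T_unit (Y : choiceType) (y : Y) : T Y := MkT (T_unit_subproof y).

Definition T_add (Y : choiceType) (u v : T Y) : T Y :=
  MkT (msetD_neq0 v (T_neq0 u)).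

Lemma T_size_gt0 (Y : choiceType) (u : T Y) : 0 < size (enum_mset (T_val u)).
Proof.
have := T_neq0 u; apply: contraNT; rewrite -eqn0Ngt size_eq0 => /eqP u0.
by rewrite -(seq_mset_id u) u0; apply/eqP/msetP => y; rewrite mset_seqE mset0E.
Qed.

(* The semigroup homomorphism T Y -> T Z extending g, k_1 y_1 + ... + k_r y_r
   being sent to k_1 (g y_1) + ... + k_r (g y_r): see T_lift_unit, T_lift_add
   and T_lift_unique. *)
Definition T_lift (Y Z : choiceType) (g : Y -> T Z) (u : T Y) : T Z :=
  MkT (big_msetD_neq0 g (T_size_gt0 u)).

Lemma T_lift_unit (Y Z : choiceType) (g : Y -> T Z) y :
  T_lift g (T_unit y) = g y.
Proof. by apply/val_inj; rewrite /= enum_msetn big_seq1. Qed.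

Lemma T_lift_add (Y Z : choiceType) (g : Y -> T Z) u v :
  T_lift g (T_add u v) = T_add (T_lift g u) (T_lift g v).
Proof.
apply/val_inj; rewrite /= -big_cat /=; apply: perm_big.
apply/allP => y _ /=; rewrite count_cat !count_mem_mset.
by rewrite msetE2.
Qed.

Lemma T_lift_unique (Y Z : choiceType) (g : Y -> T Z) (h : T Y -> T Z) :
  (forall u v, h (T_add u v) = T_add (h u) (h v)) ->
  (forall y, h (T_unit y) = g y) -> h =1 T_lift g.
Proof.
move=> hD h1 u.
have [n] := ubnP (size (enum_mset (T_val u))); elim: n u => // n IH u ltn.
have [y yu] : exists y, y \in T_val u.
  have us : enum_mset (T_val u) =i T_val u by [].
  have := T_size_gt0 u; case: (enum_mset _) us => // y s us _.
  by exists y; rewrite -us mem_head.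
case: (eqVneq (T_val u `\ y)%mset mset0) => [u0|u0].
  have -> : u = T_unit y by apply/val_inj; rewrite /= -(msetB1K yu) u0 msetD0.
  by rewrite h1 T_lift_unit.
have uE : u = T_add (T_unit y) (MkT u0) by apply/val_inj; rewrite /= msetB1K.
rewrite uE hD T_lift_add h1 T_lift_unit IH //.
rewrite -ltnS (leq_trans _ ltn) // ltnS.
have /perm_size -> : perm_eq (T_val u) (y :: (T_val u `\ y)%mset).
  apply/allP => z _ /=; rewrite !count_mem_mset eq_sym [y == z]eq_sym.
  by rewrite -mset1DE msetB1K.
by [].
Qed.

Definition T_map (Y Z : choiceType) (f : Y -> Z) : T Y -> T Z :=
  T_lift (@T_unit Z \o f).

Definition mu (Y : choiceType) : T (T Y) -> T Y := T_lift id.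

Lemma PF_size_gt0 (Y : choiceType) (A : PF Y) : 0 < size (PF_val A).
Proof. by rewrite cardfs_gt0 PF_neq0. Qed.

Definition sigma (Y : choiceType) (A : PF Y) : T Y :=
  MkT (big_msetD_neq0 (@T_unit Y) (PF_size_gt0 A)).

Lemma PF_map_subproof (Y Z : choiceType) (f : Y -> Z) (A : PF Y) :
  f @` PF_val A != fset0.
Proof.
by have /fset0Pn[y yA] := PF_neq0 A; apply/fset0Pn; exists (f y); rewrite in_imfset.
Qed.
Definition PF_map (Y Z : choiceType) (f : Y -> Z) (A : PF Y) : PF Z :=
  MkPF (PF_map_subproof f A).

Fixpoint PFn (m : nat) (Y : choiceType) : choiceType :=
  if m is m'.+1 then PF (PFn m' Y) else Y.

Fixpoint Tn (m : nat) (Y : choiceType) : choiceType :=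
  if m is m'.+1 then T (Tn m' Y) else Y.

(* sigmaS m Y is sigma^(m+1)_Y. *)
Fixpoint sigmaS (m : nat) (Y : choiceType) : PFn m.+1 Y -> Tn m.+1 Y :=
  if m is m'.+1 then @sigma (Tn m'.+1 Y) \o PF_map (@sigmaS m' Y)
  else @sigma Y.

Fixpoint mun (m : nat) (Y : choiceType) : Tn m.+1 Y -> T Y :=
  if m is m'.+1 then @mu Y \o T_map (@mun m' Y) else id.

Section IteratedComplexes.
Variables (Y : choiceType) (C : {fset {fset Y}}).
(* A term of the sequence B is a set of elements of the iterated type PFn;
   Ntilde i, St i and Ss i only involve B 0, ..., B i. *)
Variable B : forall i : nat, {fset PFn i.+1 Y}.

Fixpoint Ntilde (i : nat) : {fset {fset PFn i.+1 Y}} :=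
  if i is j.+1 then nested_complex (Ntilde j) (B j.+1)
  else nested_complex C (B 0).

Definition St (n : nat) : {fset {fset Tn n.+1 Y}} :=
  [fset (@sigmaS n Y @` N) | N : {fset PFn n.+1 Y} in Ntilde n].

Definition Ss (n : nat) : {fset {fset T Y}} :=
  [fset (@mun n Y @` a) | a : {fset Tn n.+1 Y} in St n].

End IteratedComplexes.

(* Main.v *)
Require Import Defs.
From mathcomp Require Import all_boot finmap multiset.

(** The composite of [mun n] and [sigmaS n] sends a set [A] to the sum of the
    images of its members one level down. The invariant carried through the
    levels is that a formal sum of images of vertices of one simplex determines
    both the simplex and the coefficients. It passes from [C] to the nested
    complex of [(C, B)]: a combination of members of a nested set expands to a
    combination of vertices of their union, which lies in [C]; and the maximal
    members of a nested set are recovered from the union as the maximal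
    elements of [B] below it, so they can be peeled off one by one.
    Applied to single vertices, the invariant gives injectivity. *)

Set Implicit Arguments.
Unset Strict Implicit.
Unset Printing Implicit Defensive.

Local Open Scope mset_scope.
Local Open Scope fset_scope.

(** * Building sets and the maximal members of nested sets *)

Section Complexes.
Variable Y : choiceType.
Implicit Types (C : {fset {fset Y}}) (B N : {fset PF Y}).

Lemma complex_base C a : simplicial_complex C -> a \in C ->
  exists A c, [/\ has_bases C A, c \in A & a `<=` c].
Proof.
case=> A hA aC; have [_ _ CE] := hA; move: aC; rewrite {1}CE => /bigfcupP[c].
by rewrite andbT fpowersetE => cA ac; exists A, c.
Qed.

Lemma complex_down C a b : simplicial_complex C ->
  a `<=` b -> b \in C -> a \in C.
Proof.
case=> A [_ _ ->] ab /bigfcupP[c cA]; rewrite fpowersetE => bc.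
by apply/bigfcupP; exists c; rewrite // fpowersetE (fsubset_trans ab).
Qed.

Lemma complex_fset0 C : simplicial_complex C -> fset0 \in C.
Proof.
case=> A [/fset0Pn[a aA] _ ->]; apply/bigfcupP.
by exists a; rewrite ?aA // fpowersetE fsub0set.
Qed.

Lemma sub_cup C a : a \in C -> a `<=` cup C.
Proof. by move=> aC; apply: bigfcup_sup. Qed.

Lemma in_PF_family B (b : PF Y) : (PF_val b \in PF_family B) = (b \in B).
Proof.
apply/imfsetP/idP => [[c cB /val_inj->] //|bB]; by exists b.
Qed.

Lemma PF_familyP B a :
  reflect (exists2 b, b \in B & a = PF_val b) (a \in PF_family B).
Proof. exact: imfsetP. Qed.

Lemma cup_PF_familyP N y :
  reflect (exists2 b : PF Y, b \in N & y \in PF_val b)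
          (y \in cup (PF_family N)).
Proof.
apply: (iffP (bigfcupP _ _ _ _)) => [[a]|[b bN yb]].
  by rewrite andbT => /PF_familyP[b bN ->]; exists b.
by exists (PF_val b); rewrite // in_PF_family bN.
Qed.

(** (B1) is available only inside one base; the simplex [U] supplies a base that contains both [b]
    and [c]. *)
Lemma building_union C B (b c : PF Y) U :
    simplicial_complex C -> building_set C B -> b \in B -> c \in B ->
    PF_val b `&` PF_val c != fset0 -> U \in C ->
    PF_val b `<=` U -> PF_val c `<=` U ->
  PF_val b `|` PF_val c \in PF_family B.
Proof.
move=> hC [_ hB] bB cB bc0 UC bU cU.
have [A [a [hA aA Ua]]] := complex_base hC UC.
have [_ hU _] := hB A hA a aA.
have bB' : b \in below B a by rewrite !inE bB (fsubset_trans bU).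
have cB' : c \in below B a by rewrite !inE cB (fsubset_trans cU).
have /PF_familyP[d] := hU _ _ bB' cB' bc0; rewrite !inE => /andP[dB _] ->.
by rewrite in_PF_family.
Qed.

Definition maximal_in N (M : PF Y) : bool :=
  all (fun M' => (PF_val M `<=` PF_val M') ==> (M == M')) N.

Lemma maximal_above N (b : PF Y) : b \in N ->
  exists M, [/\ M \in N, PF_val b `<=` PF_val M & maximal_in N M].
Proof.
move=> bN; pose P (i : N) := PF_val b `<=` PF_val (val i).
have P0 : P [` bN] by apply: fsubset_refl.
(* A member of largest cardinality among those above [b] is maximal in [N]. *)
case: (@arg_maxnP _ [` bN] P (fun i => #|` PF_val (val i)|) P0) => M bM maxM.
exists (val M); split; rewrite ?(valP M) //; apply/allP => M' M'N.
apply/implyP => MM'; apply/eqP/val_inj/eqP => /=; rewrite eqEfcard MM' /=.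
by apply: (maxM [` M'N]); apply: fsubset_trans MM'.
Qed.

Lemma nested_antichain C B N A : nested C B N -> A `<=` N -> 1 < #|` A| ->
  {in A, forall M, maximal_in N M} -> cup (PF_family A) \in C `\` PF_family B.
Proof.
case/andP=> _ /forallP nN AN A2 maxA.
have AP : A \in fpowerset N by rewrite fpowersetE.
apply: (implyP (nN [` AP])); rewrite /is_antichain AN A2 /=.
apply/allrelP => _ _ /PF_familyP[b bA ->] /PF_familyP[c cA ->] /=.
apply/implyP => bc; move/allP/(_ c (fsubsetP AN _ cA)): (maxA _ bA).
by rewrite bc => /eqP->.
Qed.

Lemma fset_le1 (Z : choiceType) (A : {fset Z}) M : M \in A ->
  #|` A| <= 1 -> A = [fset M].
Proof.
move=> MA; rewrite (cardfsD1 M) MA add1n ltnS leqn0 cardfs_eq0 => /eqP A0.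
by rewrite -(fsetD1K MA) A0 fsetU0.
Qed.

(** The union is already that of the maximal members. Two or more of these form an antichain, so
    nestedness applies; a single one lies in [B], hence in [C]. *)
Lemma nested_cup C B N : simplicial_complex C -> building_set C B ->
  nested C B N -> cup (PF_family N) \in C.
Proof.
move=> hC [BC _] nN; pose A := [fset M in N | maximal_in N M].
have AN : A `<=` N by apply/fsubsetP => M; rewrite !inE => /andP[].
have -> : cup (PF_family N) = cup (PF_family A).
  apply/fsetP => y; apply/cup_PF_familyP/cup_PF_familyP => -[b bN yb].
    have [M [MN bM mM]] := maximal_above bN.
    by exists M; rewrite ?inE ?MN ?mM // (fsubsetP bM).
  by exists b; rewrite // (fsubsetP AN).
have [A2|A1] := ltnP 1 #|` A|.
  have maxA M : M \in A -> maximal_in N M by rewrite !inE => /andP[].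
  by have /fsetDP[] := nested_antichain nN AN A2 maxA.
case: (fset_0Vmem A) => [->|[M MA]].
  rewrite (_ : cup _ = fset0) ?complex_fset0 //.
  by apply/fsetP => y; rewrite inE; apply/cup_PF_familyP => -[].
rewrite (fset_le1 MA A1) (_ : cup _ = PF_val M).
  have /andP[NB _] := nN.
  by rewrite (fsubsetP BC) // in_PF_family (fsubsetP NB) // (fsubsetP AN).
apply/fsetP => y; apply/cup_PF_familyP/idP => [[b /fset1P->] //|yM].
by exists M; rewrite ?inE.
Qed.

(* Otherwise b, glued by (B1) to the maximal members of N that it meets, would
   make their union an element of B, against nestedness. *)
Lemma nested_absorb C B N (b : PF Y) :
    simplicial_complex C -> building_set C B -> nested C B N ->
    b \in B -> PF_val b `<=` cup (PF_family N) ->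
  exists2 M, M \in N & PF_val b `<=` PF_val M.
Proof.
move=> hC hB nN bB bN; have /andP[NB _] := nN.
pose A := [fset M in N | maximal_in N M & PF_val b `&` PF_val M != fset0].
have AN : A `<=` N by apply/fsubsetP => M; rewrite !inE => /andP[].
have bA y : y \in PF_val b -> exists2 M, M \in A & y \in PF_val M.
  move=> yb; have /cup_PF_familyP[c cN yc] := fsubsetP bN y yb.
  have [M [MN cM mM]] := maximal_above cN.
  have yM := fsubsetP cM _ yc; exists M; rewrite // !inE MN mM /=.
  by apply/fset0Pn; exists y; rewrite inE yb.
(* By [bA] the members of [A] cover [b], so if there is only one, it contains [b]. *)
have [A2|A1] := ltnP 1 #|` A|; last first.
  have /fset0Pn[y /bA[M MA _]] := PF_neq0 b.
  exists M; first exact: (fsubsetP AN).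
  by apply/fsubsetP => z /bA[M']; rewrite (fset_le1 MA A1) => /fset1P->.
have /fsetDP[UC /negP[]] : cup (PF_family A) \in C `\` PF_family B.
  by apply: nested_antichain nN AN A2 _ => M; rewrite !inE => /and3P[].
have bU : PF_val b `<=` cup (PF_family A).
  by apply/fsubsetP => y /bA MA; apply/cup_PF_familyP.
(* The invariant keeps [b] inside [c], so that the next [M] meets [c], and keeps [c] inside the
   simplex [cup (PF_family A)], where (B1) can be used. *)
have glue (s : seq (PF Y)) : {subset s <= A} ->
  exists c : PF Y, [/\ c \in B, PF_val b `<=` PF_val c,
    PF_val c `<=` cup (PF_family A) &
    {in s, forall M, PF_val M `<=` PF_val c}].
  elim: s => [|M s IH] sA; first by exists b; split; rewrite ?fsubset_refl.
  have [|c [cB bc cU cs]] := IH.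
    by move=> M' M's; rewrite sA // inE M's orbT.
  have MA : M \in A by rewrite sA ?mem_head.
  have MU : PF_val M `<=` cup (PF_family A).
    by apply: sub_cup; rewrite in_PF_family.
  have /PF_familyP[d dB cMd] : PF_val c `|` PF_val M \in PF_family B.
    apply: building_union hC hB cB _ _ UC cU MU.
      by apply: (fsubsetP NB); apply: (fsubsetP AN).
    move: MA; rewrite !inE => /and3P[_ _ /fset0Pn[y]].
    rewrite inE => /andP[yb yM]; apply/fset0Pn; exists y.
    by rewrite inE (fsubsetP bc).
  exists d; rewrite -cMd; split => //.
  - exact: fsubset_trans (fsubsetUl _ _).
  - by rewrite fsubUset cU.
  - move=> M'; rewrite inE => /predU1P[->|/cs M'c]; first exact: fsubsetUr.
    exact: fsubset_trans (fsubsetUl _ _).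
have [c [cB _ cU Ac]] := glue A (fun _ => id).
rewrite (_ : cup _ = PF_val c) ?in_PF_family //; apply/eqP.
rewrite eqEfsubset cU andbT; apply/fsubsetP => y /cup_PF_familyP[M MA].
exact/fsubsetP/Ac.
Qed.

Lemma mem_nested_complex C B N :
  (N \in nested_complex C B) = nested C B N.
Proof.
rewrite !inE fpowersetE; case: (boolP (nested C B N)); rewrite ?andbF //.
by case/andP=> ->.
Qed.

End Complexes.

(** * Cancellation in formal sums over nested sets *)

Section UniqueDecomposition.
Variables (Y : choiceType) (C : {fset {fset Y}}) (B : {fset PF Y}).
Hypotheses (hC : simplicial_complex C) (hB : building_set C B).
Implicit Types s t : seq (PF Y).

(** Lists up to [perm_eq] stand for formal sums: [supp] forgets the coefficients, and [flat] expands
    each member into its elements, counted with multiplicity. *)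
Notation supp s := [fset x | x in s].
Notation flat s := (flatten [seq enum_fset (PF_val b) | b <- s]).

Lemma supp_flat s : supp (flat s) = cup (PF_family (supp s)).
Proof.
apply/fsetP => y; rewrite !inE; apply/flatten_mapP/cup_PF_familyP.
  by case=> b bs yb; exists b; rewrite ?inE.
by case=> b; rewrite inE; exists b.
Qed.

(** Equal expansions have equal supports, so [M] lies below the union of [t], and [nested_absorb]
    applies. *)
Lemma sub_flat s t M : nested C B (supp s) -> nested C B (supp t) ->
    perm_eq (flat s) (flat t) -> M \in s ->
  exists2 M', M' \in t & PF_val M `<=` PF_val M'.
Proof.
move=> ns nt st Ms; have [||M'] := @nested_absorb _ _ _ _ M hC hB nt.
- by case/andP: ns => /fsubsetP-> //; rewrite inE.
- rewrite -supp_flat; apply/fsubsetP => y yM; rewrite inE -(perm_mem st).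
  by apply/flatten_mapP; exists M.
by rewrite inE; exists M'.
Qed.

(** Further occurrences of [M] may keep it in the support; downward closure covers both cases. *)
Lemma nested_supp_rem s M : nested C B (supp s) -> nested C B (supp (rem M s)).
Proof.
rewrite -!mem_nested_complex; apply: complex_down; first exact: nested_complexP.
by apply/fsubsetP => x; rewrite !inE => /mem_rem.
Qed.

Lemma perm_flat_rem s M : M \in s ->
  perm_eq (flat s) (PF_val M ++ flat (rem M s)).
Proof.
by move=> Ms; rewrite -[_ ++ _]/(flat (M :: rem M s)) perm_flatten //
  perm_map // perm_to_rem.
Qed.

(* A maximal member of the support of s is a maximal element of B below the
   common union of the supports, so it can be cancelled from s and t. *)
Lemma nested_flat_inj s t : nested C B (supp s) -> nested C B (supp t) ->
  perm_eq (flat s) (flat t) -> perm_eq s t.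
Proof.
have [n] := ubnP (size s); elim: n s t => // n IH s t.
rewrite ltnS => sn ns nt st.
case: (fset_0Vmem (supp s)) => [s0|[b bs]].
  case: s s0 {sn ns} st => [_|x s /fsetP/(_ x)]; last by rewrite !inE eqxx.
  (* A nonempty [t] would have a nonempty expansion, its members being nonempty. *)
  case: t {nt} => // M t; rewrite perm_sym => /perm_nilP /= /eqP.
  rewrite -size_eq0 size_cat addn_eq0 => /andP[+ _].
  by rewrite -[size _ == 0]negbK -lt0n PF_size_gt0.
have [M [Ms _ maxM]] := maximal_above bs; rewrite inE in Ms.
have [M' M't MM'] := sub_flat ns nt st Ms.
have ts : perm_eq (flat t) (flat s) by rewrite perm_sym.
have [M'' M''s M'M''] := sub_flat nt ns ts M't.
have /eqP eM'' : M == M''.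
  move/allP/(_ M''): maxM; rewrite inE => /(_ M''s) /implyP; apply.
  exact: fsubset_trans M'M''.
have eM : M = M'.
  by apply/val_inj/eqP; rewrite /= eqEfsubset MM' /= eM''.
rewrite -eM in M't.
rewrite (permPl (perm_to_rem Ms)) perm_sym (permPl (perm_to_rem M't)) perm_cons.
rewrite perm_sym; apply: IH; rewrite ?nested_supp_rem //.
  by rewrite size_rem //; case: (s) Ms sn.
rewrite -(perm_cat2l (PF_val M)) -(permPl (perm_flat_rem Ms)) perm_sym.
by rewrite -(permPl (perm_flat_rem M't)).
Qed.

End UniqueDecomposition.

(** * Unique decomposition and its passage to the nested complex *)

Notation "\msum_ ( i <- s ) F" := (\big[@msetD _/mset0]_(i <- s) F)
  (at level 41, F at level 41, i, s at level 50,
   format "\msum_ ( i  <-  s )  F").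

(* Over the rationals: the cones spanned by the v-images of the simplices of C
   intersect along common faces, i.e. they form a fan. Coefficients are encoded
   by repetitions in the sequences s and t. *)
Definition unique_decomposition (Y X : choiceType) (v : Y -> {mset X})
    (C : {fset {fset Y}}) : Prop :=
  forall s t : seq Y, [fset x | x in s] \in C -> [fset x | x in t] \in C ->
    \msum_(y <- s) v y = \msum_(y <- t) v y -> perm_eq s t.

Lemma msum_mset1 (X : choiceType) (s : seq X) :
  \msum_(x <- s) [mset x]%mset = seq_mset s.
Proof.
elim: s => [|x s IH]; last by rewrite big_cons IH mset_cons.
by rewrite big_nil; apply/msetP => y; rewrite mset_seqE mset0E.
Qed.

Lemma unique_decomposition_mset1 (X : choiceType) (C : {fset {fset X}}) :
  unique_decomposition (fun x => [mset x]%mset) C.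
Proof. by move=> s t _ _; rewrite !msum_mset1 => /eq_seq_msetP. Qed.

(** A double sum over [s] is a single sum over [flat s], whose support is a simplex of [C] by
    [nested_cup]. Uniqueness in [C] thus identifies the expansions, and [nested_flat_inj] recovers
    the lists. *)
Lemma unique_decomposition_nested (Y X : choiceType) (v : Y -> {mset X})
    (C : {fset {fset Y}}) (B : {fset PF Y}) :
    simplicial_complex C -> building_set C B -> unique_decomposition v C ->
  unique_decomposition (fun b : PF Y => \msum_(y <- PF_val b) v y)
    (nested_complex C B).
Proof.
move=> hC hB vC s t; rewrite !mem_nested_complex => ns nt eq_st.
apply: (nested_flat_inj hC hB ns nt); apply: vC.
- by rewrite supp_flat (nested_cup hC hB).
- by rewrite supp_flat (nested_cup hC hB).
- by rewrite !big_flatten /= !big_map.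
Qed.

Lemma unique_decomposition_inj (Y X : choiceType) (v : Y -> {mset X})
    (C : {fset {fset Y}}) :
  simplicial_complex C -> unique_decomposition v C ->
  {in cup C &, injective v}.
Proof.
move=> hC vC x y xC yC vxy.
have in1 z : z \in cup C -> [fset w | w in [:: z]] \in C.
  case/bigfcupP=> a; rewrite andbT => aC za; apply: complex_down aC => //.
  by apply/fsubsetP => w; rewrite !inE orbF => /eqP->.
have /perm_mem/(_ x) : perm_eq [:: x] [:: y].
  by apply: vC; rewrite ?in1 // !big_seq1.
by rewrite !inE eqxx => /esym/eqP.
Qed.

(** * Complexes mapped by functions injective on vertices *)

Lemma imfset_inj_in (Y Z : choiceType) (f : Y -> Z) (D a b : {fset Y}) :
    {in D &, injective f} -> a `<=` D -> b `<=` D -> f @` a = f @` b ->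
  a = b.
Proof.
move=> fI; suff sub c d : c `<=` D -> d `<=` D -> f @` c = f @` d -> c `<=` d.
  by move=> aD bD fab; apply/eqP; rewrite eqEfsubset (sub a b) ?(sub b a).
move=> cD dD fcd; apply/fsubsetP => y yc.
have : f y \in f @` d by rewrite -fcd in_imfset.
by case/imfsetP=> x xd /fI -> //; [apply: (fsubsetP cD) | apply: (fsubsetP dD)].
Qed.

Lemma image_underlies_iso (Y Z : choiceType) (psi : Y -> Z)
    (C : {fset {fset Y}}) :
  simplicial_complex C -> {in cup C &, injective psi} ->
  underlies_iso psi C [fset psi @` (N : {fset Y}) | N in C].
Proof.
move=> hC inj; split => //.
- apply: down_closed_complex.
    by apply/imfsetP; exists fset0; rewrite /= ?complex_fset0 ?imfset0.
  move=> a b ab /imfsetP[N NC bN]; rewrite {b}bN in ab.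
  have aN := fsubsetP ab.
  (* The part of [N] lying over [a] is a face of [N] with image [a]. *)
  apply/imfsetP; exists [fset y in N | psi y \in a] => /=.
    by apply: complex_down NC => //; apply/fsubsetP => y; rewrite !inE => /andP[].
  apply/fsetP => z; apply/idP/imfsetP => [za|[y]].
    by have /imfsetP[y yN zy] := aN z za; exists y; rewrite // !inE yN -zy.
  by rewrite !inE => /andP[_ ya] ->.
- apply/fsetP => z; apply/imfsetP/bigfcupP => [[y /bigfcupP[N]]|[b]].
    rewrite andbT => NC yN ->; exists (psi @` N); last exact: in_imfset.
    by rewrite andbT; apply: in_imfset.
  rewrite andbT => /imfsetP[N NC ->] /imfsetP[y yN ->]; exists y => //=.
  exact: (fsubsetP (sub_cup NC)).
- move=> a aC; split=> [aC'|/imfsetP[N NC /= aN]]; first exact: in_imfset.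
  by rewrite (imfset_inj_in inj aC (sub_cup NC) aN).
Qed.

(** * The iterated maps as sums *)

Lemma sigmaE (Y : choiceType) (A : PF Y) : T_val (sigma A) = seq_mset (PF_val A).
Proof. exact: msum_mset1. Qed.

Lemma sigma_inj (Y : choiceType) : injective (@sigma Y).
Proof.
move=> A A' /(congr1 (@T_val Y)); rewrite !sigmaE => /eq_seq_msetP/perm_mem eqA.
exact/val_inj/fsetP.
Qed.

Lemma PF_map_inj (Y Z : choiceType) (f : Y -> Z) :
  injective f -> injective (PF_map f).
Proof.
move=> fI A A' /(congr1 (@PF_val Z)) /= eqA; apply: val_inj.
apply: (@imfset_inj_in _ _ f (PF_val A `|` PF_val A')) eqA.
- exact: in2W.
- exact: fsubsetUl.
- exact: fsubsetUr.
Qed.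

(** [PF_map] merges elements with equal images, which would lose terms of the sum formed by [sigma];
    injectivity rules this out. *)
Lemma sigmaS_inj m (Y : choiceType) : injective (@sigmaS m Y).
Proof.
elim: m => [|m IH]; first exact: sigma_inj.
exact: inj_comp (@sigma_inj _) (PF_map_inj IH).
Qed.

Lemma mu_T_map (Y Z : choiceType) (f : Y -> T Z) : @mu Z \o T_map f =1 T_lift f.
Proof.
apply: T_lift_unique => [u v|y] /=; first by rewrite /T_map /mu !T_lift_add.
by rewrite /T_map /mu !T_lift_unit.
Qed.

Lemma T_lift_sigma (Y Z : choiceType) (g : Y -> T Z) (A : PF Y) :
  T_val (T_lift g (sigma A)) = \msum_(y <- PF_val A) T_val (g y).
Proof.
rewrite [LHS]/= (_ : \msum_(i <- PF_val A) [mset i]%mset = seq_mset (PF_val A)).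
  exact/perm_big/perm_eq_seq_mset.
exact: msum_mset1.
Qed.

(** [mu \o T_map f] is the homomorphism extending [f], so it turns [sigma] of a set into the sum of
    the values of [f]. *)
Lemma mun_sigmaSS m (X : choiceType) (A : PFn m.+2 X) :
  T_val (mun (sigmaS A)) =
  \msum_(a <- PF_val (A : PF (PFn m.+1 X))) T_val (mun (@sigmaS m X a)).
Proof.
rewrite [mun _](mu_T_map (@mun m X) (sigmaS A)) T_lift_sigma /= big_imfset //=.
by move=> x y _ _; apply: sigmaS_inj.
Qed.

(** * Induction along the iterated nested complexes *)

Lemma unique_decomposition_ext (Y X : choiceType) (v w : Y -> {mset X})
    (C : {fset {fset Y}}) : v =1 w ->
  unique_decomposition v C -> unique_decomposition w C.
Proof.
move=> vw vC s t sC tC st; apply: vC => //.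
by under eq_bigr do rewrite vw; under [RHS]eq_bigr do rewrite vw.
Qed.

Lemma Ntilde_complex (X : choiceType) (C : {fset {fset X}})
    (B : forall i : nat, {fset PFn i.+1 X}) n :
  simplicial_complex (Ntilde C B n).
Proof. by case: n => [|n]; apply: nested_complexP. Qed.

Lemma Ntilde_unique_decomposition (X : choiceType) (C : {fset {fset X}})
    (B : forall i : nat, {fset PFn i.+1 X}) n :
    simplicial_complex C -> building_set C (B 0) ->
    (forall i, i < n -> building_set (Ntilde C B i) (B i.+1)) ->
  unique_decomposition (fun b => T_val (mun (@sigmaS n X b))) (Ntilde C B n).
Proof.
move=> hC hB0; elim: n => [_|n IH hB].
  (* At level 0 the map is [sigma], by conversion a sum of singletons [[mset x]]. *)
  exact: unique_decomposition_nested hC hB0 (@unique_decomposition_mset1 _ _).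
apply: (@unique_decomposition_ext _ _
  (fun b : PF (PFn n.+1 X) => \msum_(a <- PF_val b) T_val (mun (@sigmaS n X a)))).
  by move=> b; rewrite mun_sigmaSS.
apply: unique_decomposition_nested.
- exact: Ntilde_complex.
- exact: hB.
- by apply: IH => i ltin; apply: hB; apply: ltnW.
Qed.

Lemma Ss_image (X : choiceType) (C : {fset {fset X}})
    (B : forall i : nat, {fset PFn i.+1 X}) n :
  Ss C B n =
  [fset (@mun n X \o @sigmaS n X) @` (N : {fset PFn n.+1 X}) | N in Ntilde C B n].
Proof.
apply/fsetP => a; apply/imfsetP/imfsetP => /= -[].
  move=> b /imfsetP[N /= NN ->] ->; exists N => //; exact/esym/imfset_comp.
move=> N NN ->; exists (@sigmaS n X @` N); last exact: imfset_comp.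
exact: in_imfset.
Qed.

Theorem theorem6p8 (X : finType) (hX : (0 < #|X|)%N)
    (C : {fset {fset X}}) (hC : simplicial_complex C)
    (n : nat) (B : forall i : nat, {fset PFn i.+1 X})
    (hB0 : building_set C (B 0%N))
    (hBi : forall i : nat, (i < n)%N -> building_set (Ntilde C B i) (B i.+1)) :
  underlies_iso (@mun n X \o @sigmaS n X) (Ntilde C B n) (Ss C B n).
Proof.
have hN := Ntilde_complex C B n.
rewrite Ss_image; apply: image_underlies_iso => // x y xN yN /= eq_xy.
have vN := Ntilde_unique_decomposition hC hB0 hBi.
by apply: (unique_decomposition_inj hN vN) => //=; rewrite eq_xy.
Qed.
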